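(* The intersection number $i(\sigma,\tau)$ of a pair of splittings $\sigma,\tau$ of a group $G$ is well-defined, even if the ambient group $G$ is not finitely generated.
   Context: Intersection number: let $\sigma$ and $\tau$ be splittings of a group $G$, let $X$ be an $H$-almost invariant set arising from $\sigma$, and let $Y$ be a $K$-almost invariant set arising from $\tau$. The intersection number of $\sigma$ and $\tau$ is $i(\sigma,\tau) :=$ the number of double cosets $KgH$ ($g\in G$) such that $gX$ crosses $Y$. The terms used are as follows. For $X\subset G$, $X^*=G\setminus X$. A subset of $G$ is $H$-finite if it is contained in finitely many cosets $Hg_i$ of $H$ in $G$. A subset $X\subset G$ is $H$-almost invariant if $hX=X$ for all $h\in H$, and for all $g\in G$ the symmetric difference of $Xg$ and $X$ is $H$-finite. If $X$ is $H$-almost invariant and $Y$ is $K$-almost invariant, the corners of the pair $(X,Y)$ are $X\cap Y$, $X\cap Y^*$, $X^*\cap Y$, $X^*\cap Y^*$; $X$ crosses $Y$ if no corner of the pair $(X,Y)$ is $K$-finite. Note that $gX$ is $gHg^{-1}$-almost invariant. A $G$-tree is a simplicial tree with a simplicial $G$-action that inverts no edge. A splitting of $G$ is a $G$-tree $T$ with no global fixed points such that $G\backslash T$ has exactly one edge. An $H$-almost invariant set arising from the splitting is a set $X=\{g\in G : e \text{ points away from } gv\}$, where $v$ is a vertex of $T$, $e$ is a directed edge of $T$, and $H=\mathrm{Stab}(e)=\{g: gX=X\}$; ''$e$ points away from $gv$'' means that $gv$ lies in the component of $T$ minus the interior of $e$ containing the initial vertex of $e$. *)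

(* Defs.v *)
From HB Require Import structures.
From mathcomp Require Import all_boot monoid.
From mathcomp Require Import mathcomp_extra boolp classical_sets functions cardinality.

Set Implicit Arguments.
Unset Strict Implicit.
Unset Printing Implicit Defensive.

Local Open Scope classical_set_scope.
Local Open Scope group_scope.

Section AlmostInvariantSets.
Variable G : groupType.
Implicit Types (H K X Y : set G) (g : G).

Definition ltranslate g X : set G := [set g * x | x in X].

Definition rtranslate X g : set G := [set x * g | x in X].

Definition dcoset K g H : set G :=
  [set x | exists k h, [/\ K k, H h & x = k * g * h]].

Definition rel_finite H (A : set G) : Prop :=
  exists s : seq G, forall x, A x -> exists2 g, g \in s & rtranslate H g x.

Definition almost_invariant H X : Prop :=
  (forall h, H h -> ltranslate h X = X) /\
  (forall g, rel_finite H (rtranslate X g `+` X)).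

Definition crosses K X Y : Prop :=
  [/\ ~ rel_finite K (X `&` Y),
      ~ rel_finite K (X `&` ~` Y),
      ~ rel_finite K (~` X `&` Y) &
      ~ rel_finite K (~` X `&` ~` Y)].

Definition crossing_dcosets H X K Y : set (set G) :=
  [set D | exists2 g, D = dcoset K g H & crosses K (ltranslate g X) Y].

End AlmostInvariantSets.

(* A simplicial tree is a connected simple graph without simple cycles; a     *)
(* simple closed walk of size 2 merely traverses one edge back and forth.     *)
Record gtree (G : groupType) := GTree {
  vertex :> eqType;
  adj : rel vertex;
  act : G -> vertex -> vertex;
  adj_sym : symmetric adj;
  adj_irr : irreflexive adj;
  tree_connected :
    forall x y : vertex, exists2 p, path adj x p & last x p = y;
  tree_acyclic : forall c : seq vertex, ucycle adj c -> size c <= 2;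
  act1 : forall x, act 1 x = x;
  actM : forall g h x, act (g * h) x = act g (act h x);
  act_adj : forall g x y, adj (act g x) (act g y) = adj x y;
  no_inversion : forall g x y, adj x y -> ~ (act g x = y /\ act g y = x)
}.

(* As no edge is inverted, an element fixing an interior point of an edge     *)
(* fixes both ends, so it suffices to exclude global fixed vertices.          *)
Definition no_global_fixed_point (G : groupType) (T : gtree G) : Prop :=
  ~ exists x : T, forall g, act g x = x.

Definition one_edge_quotient (G : groupType) (T : gtree G) : Prop :=
  (exists x y : T, adj x y) /\
  (forall x y x' y' : T, adj x y -> adj x' y' ->
     exists g, (act g x = x' /\ act g y = y') \/ (act g x = y' /\ act g y = x')).

Record splitting (G : groupType) := Splitting {
  splitting_tree :> gtree G;
  splitting_no_fix : no_global_fixed_point splitting_tree;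
  splitting_one_edge : one_edge_quotient splitting_tree
}.

(* The directed edge e goes from e.1 to e.2.                                  *)
Section HalfTrees.
Variables (G : groupType) (T : gtree G).
Implicit Type e : T * T.

Definition directed_edge e : Prop := adj e.1 e.2.

Definition remove_edge e : rel T :=
  [rel x y | [&& adj x y, (x, y) != e & (y, x) != e]].

Definition initial_component e : set T :=
  [set x | exists2 p, path (remove_edge e) e.1 p & last e.1 p = x].

Definition edge_stab e : set G :=
  [set g | act g e.1 = e.1 /\ act g e.2 = e.2].

Definition points_away_set e (v : T) : set G :=
  [set g | initial_component e (act g v)].

End HalfTrees.

Definition arises_from (G : groupType) (s : splitting G) (H X : set G) : Prop :=
  exists (v : s) (e : s * s),
    [/\ directed_edge e, H = edge_stab e & X = points_away_set e v].

(* Main.v *)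
Require Import Defs.
From HB Require Import structures.
From mathcomp Require Import all_boot monoid.
From mathcomp Require Import mathcomp_extra boolp classical_sets functions cardinality.

Set Implicit Arguments.
Unset Strict Implicit.
Unset Printing Implicit Defensive.

Local Open Scope classical_set_scope.
Local Open Scope card_scope.
Local Open Scope group_scope.

(* Say that X comes from the edge e and base vertex v of sigma, and Y from    *)
(* the edge f and base vertex w of tau. Replacing e or f by a translate       *)
(* permutes the double cosets, and reversing e or f complements X or Y, which *)
(* permutes the corners. So the point is that Stab(f)-finiteness of a corner  *)
(* does not depend on v and w. Changing w alters Y by a Stab(f)-finite set.   *)
(* For v, a one-edge tree without global fixed point has no valence-one       *)
(* vertex off the orbit of v, so every vertex v' lies between two translates  *)
(* of v by fixed elements a, b of G: a half-tree containing x v' contains     *)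
(* x a v or x b v. This embeds the corner based at v' into two right          *)
(* translates of the corner based at v, and right translation preserves       *)
(* Stab(f)-finiteness.                                                        *)

Section Cosets.
Variable G : groupType.
Implicit Types (H K A B : set G) (g b : G).

Definition conjugate g H : set G := [set x | H (g^-1 * x * g)].

Lemma ltranslateE g A : ltranslate g A = [set x | A (g^-1 * x)].
Proof.
apply/seteqP; split=> x /=; first by case=> y Ay <-; rewrite mulKg.
by move=> Ax; exists (g^-1 * x); rewrite ?mulVKg.
Qed.

Lemma rtranslateE A g : rtranslate A g = [set x | A (x * g^-1)].
Proof.
apply/seteqP; split=> x /=; first by case=> y Ay <-; rewrite mulgK.
by move=> Ax; exists (x * g^-1); rewrite ?mulgVK.
Qed.

Lemma ltranslateM g b A : ltranslate (g * b) A = ltranslate g (ltranslate b A).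
Proof.
by rewrite !ltranslateE; apply/seteqP; split=> x /=; rewrite invgM mulgA.
Qed.

Lemma rel_finite_sub H A B : A `<=` B -> rel_finite H B -> rel_finite H A.
Proof. by move=> AB [s Hs]; exists s => x /AB/Hs. Qed.

Lemma rel_finiteU H A B :
  rel_finite H A -> rel_finite H B -> rel_finite H (A `|` B).
Proof.
move=> [s Hs] [t Ht]; exists (s ++ t) => x [/Hs|/Ht] [g gs xg]; exists g => //;
  by rewrite mem_cat gs ?orbT.
Qed.

Lemma rel_finite_coset H A :
  (forall x y, A x -> A y -> H (x * y^-1)) -> rel_finite H A.
Proof.
move=> HA; have [[y Ay]|nA] := pselect (exists y, A y).
  exists [:: y] => x Ax; exists y; rewrite ?inE// rtranslateE /=; exact: HA.
by exists [::] => x Ax; case: nA; exists x.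
Qed.

Lemma rel_finite_mulr H A g :
  rel_finite H A -> rel_finite H [set x | A (x * g)].
Proof.
move=> [s Hs]; exists [seq a * g^-1 | a <- s] => x /= /Hs[a sa].
rewrite rtranslateE /= => Hx; exists (a * g^-1); first exact: map_f.
by rewrite rtranslateE /= invgM invgK mulgA.
Qed.

(** Left translation by [b] carries the coset $Hg$ to the coset of $bg$ for $bHb^{-1}$. *)
Lemma rel_finite_ltranslate b H A :
  rel_finite (conjugate b H) (ltranslate b A) -> rel_finite H A.
Proof.
rewrite ltranslateE => -[s Hs]; exists [seq b^-1 * g | g <- s] => x Ax.
have [|g sg] := Hs (b * x); first by rewrite /= mulKg.
rewrite rtranslateE /= => Hx; exists (b^-1 * g); first exact: map_f.
by move: Hx; rewrite rtranslateE /conjugate /= invgM invgK !mulgA mulVg mul1g.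
Qed.

Lemma crosses_ltranslate b K A B : crosses K A B ->
  crosses (conjugate b K) (ltranslate b A) (ltranslate b B).
Proof.
rewrite !ltranslateE => -[c1 c2 c3 c4].
have fin C : rel_finite (conjugate b K) [set x | C (b^-1 * x)] ->
  rel_finite K C by move=> ?; apply: (@rel_finite_ltranslate b); rewrite ltranslateE.
by split=> F; [apply: c1|apply: c2|apply: c3|apply: c4]; apply: fin; exact: F.
Qed.

Lemma crosses_setCl K A B : crosses K (~` A) B <-> crosses K A B.
Proof. by split=> -[]; rewrite ?setCK; split; rewrite ?setCK. Qed.

Lemma crosses_setCr K A B : crosses K A (~` B) <-> crosses K A B.
Proof. by split=> -[]; rewrite ?setCK; split; rewrite ?setCK. Qed.

Lemma dcoset_conjugate b g a K H :
  dcoset (conjugate b K) (b * g * a^-1) (conjugate a H) =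
  [set x | dcoset K g H (b^-1 * x * a)].
Proof.
apply/seteqP; split=> x /= [k [h []]].
  move=> Kk Hh ->; exists (b^-1 * k * b), (a^-1 * h * a); split=> //.
  by rewrite !mulgA.
move=> Kk Hh xE; exists (b * k * b^-1), (a * h * a^-1); split.
- by rewrite /conjugate /= !mulgA mulVg mul1g mulgVK.
- by rewrite /conjugate /= !mulgA mulVg mul1g mulgVK.
- rewrite -(mulVKg b x) -(mulgK a (b * _)) -(mulgA b) xE.
  by rewrite !mulgA !mulgVK.
Qed.

End Cosets.

(** * Half-trees and the subsets of [G] they define *)

Section HalfTreeSets.
Variables (G : groupType) (T : gtree G).
Implicit Types (g : G) (v w : T) (e : T * T) (S : set T).

Definition flip e := (e.2, e.1).

Definition act_edge g e := (act g e.1, act g e.2).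

(** The component at the source of [e], described by its boundary: [e] is the only directed edge
    leaving [S]. Translates and complements then need no paths. *)
Definition half_tree e S : Prop :=
  directed_edge e /\ forall x y, adj x y -> (S x /\ ~ S y <-> (x, y) = e).

Definition orbit_set S v : set G := [set g | S (act g v)].

Lemma actK g : cancel (@act G T g) (act g^-1).
Proof. by move=> v; rewrite -actM mulVg act1. Qed.

Lemma actVK g : cancel (@act G T g^-1) (act g).
Proof. by move=> v; rewrite -actM mulgV act1. Qed.

Lemma adj_ind (P : T -> Prop) v :
  P v -> (forall x y, adj x y -> P x -> P y) -> forall w, P w.
Proof.
move=> Pv PS w; have [p + <-] := tree_connected v w.
by elim: p v Pv => //= y p IH v Pv /andP[vy] /IH; apply; apply: PS Pv.
Qed.

Lemma act_edge_flip g e : act_edge g (flip e) = flip (act_edge g e).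
Proof. by []. Qed.

Lemma act_edgeM g h e : act_edge (g * h) e = act_edge g (act_edge h e).
Proof. by rewrite /act_edge !actM. Qed.

Lemma half_tree_source e S : half_tree e S -> S e.1 /\ ~ S e.2.
Proof. by case=> ade /(_ _ _ ade) ->; case: e {ade}. Qed.

(** A simple path from [e.1] to [e.2] avoiding [e] would close up with [e] to a simple cycle. *)
Lemma component_target e : directed_edge e -> ~ initial_component e e.2.
Proof.
move=> ade [p pth]; case/shortenP: pth => q pq uq _ lq.
have pqa : path (@adj G T) e.1 q by apply: sub_path pq => x y /and3P[].
have /tree_acyclic : ucycle (@adj G T) (e.1 :: q).
  by rewrite /ucycle /= rcons_path pqa lq adj_sym ade; rewrite /= in uq.
(* Acyclicity leaves only paths with at most one edge: the empty path, which would make [e] a loop,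
   and [e] itself, which was removed. *)
case: q pq lq {pqa uq} => [|y [|//]] /=.
  by move=> _ E; move: ade; rewrite /directed_edge E adj_irr.
by move=> + E; rewrite E /remove_edge /=; case: (e) => a b; rewrite /= eqxx andbF.
Qed.

Lemma half_tree_component e :
  directed_edge e -> half_tree e (initial_component e).
Proof.
move=> ade; have source : initial_component e e.1 by exists [::].
split=> // x y xy; split=> [[[p pth lp] ny]|<-]; last first.
  by split; [exists [::]|exact: (@component_target (x, y))].
apply: contra_notP ny => /eqP nxy.
have [yx|nyx] := eqVneq (y, x) e; first by move: source; rewrite -yx.
exists (rcons p y); last by rewrite last_rcons.
by rewrite rcons_path pth lp /remove_edge /= xy nxy nyx.
Qed.

Lemma half_tree_act g e S :
  half_tree e S -> half_tree (act_edge g e) [set x | S (act g^-1 x)].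
Proof.
case=> ade eS; split; first by rewrite /directed_edge act_adj.
move=> x y; rewrite -(act_adj g^-1) => /eS /= ->.
split=> [<-|[-> ->]]; first by rewrite /act_edge /= !actVK.
by rewrite !actK -surjective_pairing.
Qed.

Lemma half_tree_flip e S : half_tree e S -> half_tree (flip e) (~` S).
Proof.
case=> ade eS; split; first by rewrite /directed_edge adj_sym.
move=> x y; rewrite adj_sym => /eS yx /=; split=> [[nSx /contrapT Sy]|].
  by have <- : (y, x) = e by apply/yx.
case=> xe ye; have [//|Sy nSx] := iffRL yx; first by rewrite xe ye; case: (e).
by split=> // /(_ Sy).
Qed.

Lemma half_tree_unique e S S' : half_tree e S -> half_tree e S' -> S = S'.
Proof.
move=> hS hS'; have [Se _] := half_tree_source hS.
have [Se' _] := half_tree_source hS'.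
suff SS z : S z <-> S' z by apply/seteqP; split=> z /SS.
move: z; apply: (@adj_ind _ e.1) => // x y xy IH.
have := hS.2 _ _ xy; have := hS'.2 _ _ xy.
have yx : adj y x by rewrite adj_sym.
have := hS.2 _ _ yx; have := hS'.2 _ _ yx.
have [] := pselect (S x); have [] := pselect (S y); have [] := pselect (S' y);
  tauto.
Qed.

Lemma half_tree_eq_or_flip e S e' S' : half_tree e S -> half_tree e' S' ->
  e' = e \/ e' = flip e -> S' = S \/ S' = ~` S.
Proof.
move=> eS eS' ee; case: ee eS' => -> eS'; [left|right].
  exact: half_tree_unique eS' eS.
exact: half_tree_unique eS' (half_tree_flip eS).
Qed.

Lemma edge_stab_flip e : edge_stab (flip e) = edge_stab e.
Proof. by apply/seteqP; split=> x []. Qed.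

Lemma edge_stab_act g e : edge_stab (act_edge g e) = conjugate g (edge_stab e).
Proof.
apply/seteqP; split=> x []; rewrite /conjugate /act_edge /=.
  by move=> xe1 xe2; split; rewrite !actM ?xe1 ?xe2 actK.
by rewrite !actM => /(canRL (actVK g)) xe1 /(canRL (actVK g)).
Qed.

Lemma ltranslate_orbit_set g S v :
  ltranslate g (orbit_set S v) = orbit_set [set x | S (act g^-1 x)] v.
Proof.
by rewrite ltranslateE; apply/seteqP; split=> x; rewrite /orbit_set /= actM.
Qed.

(** If [x] moves [v] into [S] and [w] out of it, then [x] carries some edge of a fixed path from [v]
    to [w] onto [e]. For each edge of the path, such [x] lie in a single right coset of
    [edge_stab e]. *)
Lemma orbit_set_diff_finite e S v w : half_tree e S ->
  rel_finite (edge_stab e) [set x | S (act x v) /\ ~ S (act x w)].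
Proof.
move=> eS; have [p + <-] := tree_connected v w; elim: p v => [|y p IH] v /=.
  by move=> _; exists [::] => x [].
move=> /andP[vy /IH fin].
apply: (@rel_finite_sub _ _ _ ([set x | S (act x v) /\ ~ S (act x y)] `|`
    [set x | S (act x y) /\ ~ S (act x (last y p))])).
  by move=> x [Sx nSx]; have [Sy|nSy] := pselect (S (act x y)); [right|left].
apply: rel_finiteU fin; apply: rel_finite_coset => x z.
have cross g : S (act g v) /\ ~ S (act g y) -> (act g v, act g y) = e.
  by apply: (eS.2 _ _ _).1; rewrite act_adj.
move=> /cross ex /cross ez; split; rewrite -{1}ez actM actK.
  by rewrite -ex.
by rewrite -ex.
Qed.

End HalfTreeSets.

(** * Vertex orbits in a splitting, and the stabiliser of an orbit set *)

Section Splittings.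
Variables (G : groupType) (s : splitting G).
Implicit Types (g : G) (v w : s) (e : s * s) (S : set s).

Lemma neighbour v : exists w, adj v w.
Proof.
have [[a [b ab]] _] := splitting_one_edge s.
move: v; apply: (@adj_ind _ _ _ a); first by exists b.
by move=> x y xy _; exists x; rewrite adj_sym.
Qed.

Lemma orbit_meets_edge x y v :
  adj x y -> exists g, act g v = x \/ act g v = y.
Proof.
have [w vw] := neighbour v => /((splitting_one_edge s).2 _ _ _ _ vw).
by case=> g [] [] <- <-; exists g; [left|right].
Qed.

(* If [v'] had a single neighbour [u], then [T] would be a star with centre   *)
(* [u], and [u] would be a global fixed point.                                *)
Lemma orbit_or_two_neighbours v v' :
  (exists g, act g v = v') \/
  exists a b, [/\ adj v' (act a v), adj v' (act b v) & act a v <> act b v].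
Proof.
have [|off] := pselect (exists g, act g v = v'); [by left|right].
have orb y : adj v' y -> exists g, act g v = y.
  by case/(orbit_meets_edge v) => g [gv|]; [case: off|]; exists g.
have [u v'u] := neighbour v'; have [a au] := orb _ v'u.
apply: contrapT => uniq; apply: (splitting_no_fix (s := s)); exists u.
have leaf y : adj v' y -> y = u.
  move=> v'y; have [b bE] := orb _ v'y; apply: contrapT => yu; apply: uniq.
  by exists a, b; rewrite au bE; split=> // uy; apply: yu.
(* An edge at [u] is a translate of the edge from [v'] to [u]. No translate of [v'] is [u], because
   [u] is in the orbit of [v] and [v'] is not. *)
have star1 z : adj u z -> exists h, act h v' = z /\ act h u = u.
  case/((splitting_one_edge s).2 _ _ _ _ v'u) => h [] [h1 h2]; last by exists h.
  by case: off; exists (h^-1 * a); rewrite actM au -h1 actK.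
have star z : z = u \/ adj u z.
  move: z; apply: (@adj_ind _ _ _ u); first by left.
  move=> x y xy [xu|/star1 [h [hv' hu]]]; first by right; rewrite -xu.
  left; rewrite -hu; apply: (canRL (actVK _)); apply: leaf.
  by rewrite -(act_adj h) actVK hv'.
move=> g; have [//|/star1 [h [hg _]]] := star (act g u).
by case: off; exists (h^-1 * g * a); rewrite !actM au -hg actK.
Qed.

(* [v'] lies between two translates of [v], so a half-tree containing [v']    *)
(* contains one of them.                                                      *)
Lemma half_tree_orbit v v' : exists a b, forall e S x, half_tree e S ->
  S (act x v') -> S (act (x * a) v) \/ S (act (x * b) v).
Proof.
have [[a av]|[a [b [va vb ab]]]] := orbit_or_two_neighbours v v'.
  by exists a, a => e S x _; rewrite actM av; left.
exists a, b => e S x eS Sx; apply: contrapT => /not_orP[na nb].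
rewrite !actM in na nb; apply: ab; apply: (can_inj (actK x)).
have xa : (act x v', act x (act a v)) = e.
  by apply: (eS.2 _ _ _).1; rewrite ?act_adj.
have : (act x v', act x (act b v)) = e.
  by apply: (eS.2 _ _ _).1; rewrite ?act_adj.
by rewrite -xa => -[].
Qed.

(** Suppose [z] violates the claim; it is off the orbit of [v] and has two neighbours in that orbit.
    A neighbour outside [S] makes its edge from [z] equal to [e]; one inside [S] does so for its
    edge to [z] translated by [g^-1]. Two neighbours of the same kind coincide, and two of different
    kinds put [z] in the orbit. *)
Lemma half_tree_orbit_stable e S g v : half_tree e S ->
  (forall x, S (act x v) <-> S (act g^-1 (act x v))) ->
  forall z, S z -> S (act g^-1 z).
Proof.
move=> eS gS z Sz.
have off x : act x v = z -> S (act g^-1 z) by move=> xz; rewrite -xz -gS xz.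
have [[x /off //]|[a [b [za zb ab]]]] := orbit_or_two_neighbours v z.
apply: contrapT => nSz.
have out x : adj z (act x v) -> ~ S (act x v) -> (z, act x v) = e.
  by move=> zx nSx; apply/(eS.2 _ _ zx).
have into x : adj z (act x v) -> S (act x v) ->
    (act g^-1 (act x v), act g^-1 z) = e.
  move=> zx Sx; apply: (eS.2 _ _ _).1; first by rewrite act_adj adj_sym.
  by split=> //; apply/gS.
have mixed x y : adj z (act x v) -> adj z (act y v) ->
    S (act x v) -> ~ S (act y v) -> False.
  move=> zx zy /(into _ zx) ex /(out _ zy); rewrite -ex => -[_ yz].
  by apply: nSz; apply: (off (g * y)); rewrite actM yz actVK.
have [Sa|nSa] := pselect (S (act a v)); have [Sb|nSb] := pselect (S (act b v)).
- apply: ab; apply: (can_inj (actK g^-1)).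
  by move: (into _ zb Sb); rewrite -(into _ za Sa) => -[].
- exact: (mixed a b).
- exact: (mixed b a).
- by apply: ab; move: (out _ zb nSb); rewrite -(out _ za nSa) => -[].
Qed.

(** An element preserving the orbit set preserves [S] at all vertices, by [half_tree_orbit_stable]
    for it and its inverse, hence fixes the only edge leaving [S]. *)
Lemma orbit_set_stab e S v : half_tree e S ->
  edge_stab e = [set g | ltranslate g (orbit_set S v) = orbit_set S v].
Proof.
move=> eS; apply/seteqP; split=> g /=; rewrite ltranslate_orbit_set.
  case=> ge1 ge2; congr (orbit_set _ v); apply: (@half_tree_unique _ _ e) => //.
  rewrite {1}[e]surjective_pairing -{1}ge1 -{1}ge2; exact: half_tree_act.
move=> gS; have gSE x : S (act g^-1 (act x v)) = S (act x v).
  by move/(congr1 (@^~ x)): gS.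
have Sg z : S z <-> S (act g^-1 z).
  split; first by apply: (@half_tree_orbit_stable e _ _ v) => // x; rewrite gSE.
  have := @half_tree_orbit_stable e S g^-1 v eS; rewrite invgK => stable.
  rewrite -{2}(actVK g z); apply: stable => x.
  by rewrite -actM -(gSE (g * x)) actM actK.
have [Se1 nSe2] := half_tree_source eS.
have : (act g e.1, act g e.2) = e.
  apply: (eS.2 _ _ _).1; first by rewrite act_adj; exact: eS.1.
  by split; [apply/Sg; rewrite actK|move/Sg; rewrite actK].
by move=> E; split; [move: (congr1 fst E)|move: (congr1 snd E)].
Qed.

End Splittings.

(** Right translation by [g] only moves the base vertex, to [act g^-1 v]. *)
Lemma almost_invariant_orbit_set (G : groupType) (T : gtree G) (e : T * T)
    (S : set T) (v : T) :
  half_tree e S -> almost_invariant (edge_stab e) (orbit_set S v).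
Proof.
move=> eS; split=> [h [he1 he2]|g].
  rewrite ltranslate_orbit_set; congr (orbit_set _ v).
  apply: (@half_tree_unique _ _ e) => //.
  rewrite {1}[e]surjective_pairing -{1}he1 -{1}he2; exact: half_tree_act.
rewrite rtranslateE; apply: rel_finiteU.
  have := orbit_set_diff_finite (act g^-1 v) v eS.
  by apply: rel_finite_sub => x; rewrite /orbit_set /= actM.
have := orbit_set_diff_finite v (act g^-1 v) eS.
by apply: rel_finite_sub => x; rewrite /orbit_set /= actM.
Qed.

(** * Crossing is independent of base vertices and of the choice of edges *)

Section Crossing.
Variables (G : groupType) (sigma tau : splitting G).
Implicit Types (g : G) (v : sigma) (w : tau).
Implicit Types (e : sigma * sigma) (f : tau * tau).
Implicit Types (S : set sigma) (R : set tau).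

(* Almost invariance of the first set does not help here, as it only controls *)
(* that set up to [Stab e]-finite sets. Instead, [x v'] in [S] puts [x a v]   *)
(* or [x b v] in [S], so the new corner lies in two right translates of the   *)
(* old one, up to the [Stab f]-finite change of [w].                          *)
Lemma corner_finite_vertices e S v v' f R w w' :
  half_tree e S -> half_tree f R ->
  rel_finite (edge_stab f) (orbit_set S v `&` orbit_set R w) ->
  rel_finite (edge_stab f) (orbit_set S v' `&` orbit_set R w').
Proof.
move=> eS fR fin; have [a [b ab]] := half_tree_orbit v v'.
pose near g := [set x | (orbit_set S v `&` orbit_set R w) (x * g)] `|`
  [set x | R (act x w') /\ ~ R (act x (act g w))].
have fin_near g : rel_finite (edge_stab f) (near g).
  apply: rel_finiteU; first exact: rel_finite_mulr.
  exact: orbit_set_diff_finite.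
apply: rel_finite_sub (rel_finiteU (fin_near a) (fin_near b)).
move=> x [/(ab _ _ _ eS) Sx Rx].
have mem g : S (act (x * g) v) -> near g x.
  move=> Sg; have [Rg|nRg] := pselect (R (act (x * g) w)); first by left.
  by right; split=> //; rewrite -actM.
by case: Sx => [/mem|/mem]; [left|right].
Qed.

Lemma crosses_vertices e S v v' f R w w' :
  half_tree e S -> half_tree f R ->
  crosses (edge_stab f) (orbit_set S v) (orbit_set R w) ->
  crosses (edge_stab f) (orbit_set S v') (orbit_set R w').
Proof.
move=> eS fR [c1 c2 c3 c4].
have [eS' fR'] := (half_tree_flip eS, half_tree_flip fR).
have := @corner_finite_vertices (flip e) (~` S) v' v (flip f) (~` R) w' w.
have := @corner_finite_vertices (flip e) (~` S) v' v f R w' w.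
have := @corner_finite_vertices e S v' v (flip f) (~` R) w' w.
have := @corner_finite_vertices e S v' v f R w' w.
rewrite edge_stab_flip => F1 F2 F3 F4.
by split=> fin; [apply: c1; apply: F1|apply: c2; apply: F2
  |apply: c3; apply: F3|apply: c4; apply: F4].
Qed.

Lemma crosses_half_trees e S v e' S' v' f R w f' R' w' :
  half_tree e S -> half_tree f R -> half_tree e' S' -> half_tree f' R' ->
  e' = e \/ e' = flip e -> f' = f \/ f' = flip f ->
  crosses (edge_stab f) (orbit_set S v) (orbit_set R w) ->
  crosses (edge_stab f') (orbit_set S' v') (orbit_set R' w').
Proof.
move=> eS fR eS' fR' ee ff /(crosses_vertices v' w' eS fR) cr.
have -> : edge_stab f' = edge_stab f by case: ff => ->; rewrite ?edge_stab_flip.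
have [->|->] := half_tree_eq_or_flip fR fR' ff;
  have [->|->] := half_tree_eq_or_flip eS eS' ee;
  by rewrite ?(propext (crosses_setCl _ _ _), propext (crosses_setCr _ _ _)).
Qed.

(** Translate the whole pair by [b]: up to reversal, [b * g * a^-1] carries [e'] to the same edge as
    [b * g] carries [e]. *)
Lemma crosses_translate a b g e v e' v' f w f' w' :
  directed_edge e -> directed_edge e' -> directed_edge f -> directed_edge f' ->
  e' = act_edge a e \/ e' = flip (act_edge a e) ->
  f' = act_edge b f \/ f' = flip (act_edge b f) ->
  crosses (edge_stab f) (ltranslate g (points_away_set e v))
    (points_away_set f w) ->
  crosses (edge_stab f') (ltranslate (b * g * a^-1) (points_away_set e' v'))
    (points_away_set f' w').
Proof.
move=> /half_tree_component eU /half_tree_component eU'.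
move=> /half_tree_component fU /half_tree_component fU' ee ff.
move=> /(crosses_ltranslate b); rewrite -edge_stab_act -ltranslateM.
rewrite !(@ltranslate_orbit_set _ _ _ (initial_component _)).
apply: crosses_half_trees (half_tree_act _ eU) (half_tree_act _ fU)
  (half_tree_act _ eU') fU' _ ff.
by case: ee => ->; [left|right];
  rewrite ?act_edge_flip -act_edgeM mulgVK.
Qed.

End Crossing.

(** * Comparison of the sets of crossing double cosets *)

Lemma arises_from_edges (G : groupType) (s : splitting G) (e e' : s * s) :
  directed_edge e -> directed_edge e' ->
  exists a, e' = act_edge a e \/ e' = flip (act_edge a e).
Proof.
move=> ade ade'; have [a aE] := (splitting_one_edge s).2 _ _ _ _ ade ade'.
exists a; rewrite (surjective_pairing e') /act_edge /flip /=.
by case: aE => -[-> ->]; [left|right].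
Qed.

Lemma card_crossing_dcosets_le (G : groupType) (sigma tau : splitting G)
    (H X K Y H' X' K' Y' : set G) :
  arises_from sigma H X -> arises_from tau K Y ->
  arises_from sigma H' X' -> arises_from tau K' Y' ->
  crossing_dcosets H X K Y #<= crossing_dcosets H' X' K' Y'.
Proof.
move=> [v [e [ade -> ->]]] [w [f [adf -> ->]]].
move=> [v' [e' [ade' -> ->]]] [w' [f' [adf' -> ->]]].
have [a ae] := arises_from_edges ade ade'.
have [b bf] := arises_from_edges adf adf'.
(* This is $D \mapsto bDa^{-1}$, which sends $KgH$ to the double coset of $bga^{-1}$ for the
   conjugated stabilisers. *)
pose move_dcoset (D : set G) := [set x | D (b^-1 * x * a)].
have inj_move : injective move_dcoset.
  apply: (can_inj (g := fun D => [set x | D (b * x * a^-1)])) => D.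
  by apply/seteqP; split=> x; rewrite /move_dcoset /= !mulgA mulVg mul1g mulgVK.
apply: card_le_trans (card_ge_preimage (f := move_dcoset) _); last first.
  by move=> D D' _ _; exact: inj_move.
apply: subset_card_le => _ [g -> cr] /=; exists (b * g * a^-1).
  rewrite /move_dcoset -dcoset_conjugate -!edge_stab_act.
  by case: ae => ->; case: bf => ->; rewrite ?edge_stab_flip.
exact: crosses_translate ae bf cr.
Qed.

Lemma crosses_dcoset (G : groupType) (sigma tau : splitting G)
    (H X K Y : set G) (g g' : G) :
  arises_from sigma H X -> arises_from tau K Y ->
  dcoset K g H = dcoset K g' H ->
  crosses K (ltranslate g X) Y -> crosses K (ltranslate g' X) Y.
Proof.
move=> [v [e [ade -> ->]]] [w [f [adf -> ->]]] gg'.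
have : dcoset (edge_stab f) g' (edge_stab e) g'.
  by exists 1, 1; rewrite /edge_stab /= !act1 mulg1 mul1g.
(* Writing [h] as an inverse gives [g'] the form [b * g * a^-1] with [b = k] fixing [f] and
   [a = h^-1] fixing [e]. *)
rewrite -gg' => -[k [h [[k1 k2] [h1 h2] ->]]] cr; rewrite -(invgK h).
apply: crosses_translate cr => //; left.
  rewrite /act_edge -h1 -h2 !actK; exact: surjective_pairing.
rewrite /act_edge k1 k2; exact: surjective_pairing.
Qed.

Lemma arises_from_exists (G : groupType) (s : splitting G) :
  exists H X, arises_from s H X.
Proof.
have [[x [y xy]] _] := splitting_one_edge s.
by exists (edge_stab (x, y)), (points_away_set (x, y) x), x, (x, y).
Qed.

Lemma arises_from_almost_invariant (G : groupType) (s : splitting G)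
    (H X : set G) :
  arises_from s H X ->
  almost_invariant H X /\ H = [set g | ltranslate g X = X].
Proof.
move=> [v [e [/half_tree_component eU -> ->]]].
by split; [exact: almost_invariant_orbit_set|exact: orbit_set_stab].
Qed.

(* The data in the definition of i(sigma, tau) exist and are as that          *)
(* definition presupposes; whether g X crosses Y depends only on K g H; and   *)
(* the cardinality of the set of crossing double cosets does not depend on    *)
(* the almost invariant sets chosen.                                          *)
Theorem corollary4p3 (G : groupType) (sigma tau : splitting G) :
  [/\ (exists H X, arises_from sigma H X) /\ (exists K Y, arises_from tau K Y),
      (forall H X, arises_from sigma H X ->
         almost_invariant H X /\ H = [set g | ltranslate g X = X]) /\
      (forall K Y, arises_from tau K Y ->
         almost_invariant K Y /\ K = [set g | ltranslate g Y = Y]),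
      (forall H X K Y, arises_from sigma H X -> arises_from tau K Y ->
         forall g g', dcoset K g H = dcoset K g' H ->
           crosses K (ltranslate g X) Y <-> crosses K (ltranslate g' X) Y) &
      (forall H X K Y H' X' K' Y',
         arises_from sigma H X -> arises_from tau K Y ->
         arises_from sigma H' X' -> arises_from tau K' Y' ->
         crossing_dcosets H X K Y #= crossing_dcosets H' X' K' Y')].
Proof.
split.
- by split; exact: arises_from_exists.
- by split=> ? ? /arises_from_almost_invariant.
- by move=> H X K Y sX tY g g' gg'; split;
    [exact: crosses_dcoset sX tY gg'|exact: crosses_dcoset sX tY (esym gg')].
- move=> H X K Y H' X' K' Y' sX tY sX' tY'; rewrite card_eq_le; apply/andP; split;
    [exact: card_crossing_dcosets_le sX tY sX' tY'
    |exact: card_crossing_dcosets_le sX' tY' sX tY].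
Qed.
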